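(* The category $\mathbf{Cmp}$ of compactological sets is coregular. The same holds for the category $\mathbf{Cmp}_\kappa$ of $\kappa$-compactological sets, for every uncountable strong limit cardinal $\kappa$.
   Context: ''Compact'' always means quasi-compact and Hausdorff. A compactological set is a triple $(X,\mathscr C,(\tau_K)_{K\in\mathscr C})$ where $X$ is a set, $\mathscr C\subseteq\mathcal P(X)$ is a non-empty collection (the compactology), and each $\tau_K$ is a topology on $K$ such that $(K,\tau_K)$ is compact and: (a) $\bigcup\mathscr C=X$; (b) for $K_1,K_2\in\mathscr C$ there is $K_3\in\mathscr C$ with $K_1\cup K_2\subseteq K_3$; (c) $\tau_{K_2}=\tau_{K_1}|_{K_2}$ for $K_2\subseteq K_1$ in $\mathscr C$; (d) compact subsets of $(K_1,\tau_{K_1})$, $K_1\in\mathscr C$, belong to $\mathscr C$. Morphisms are maps $f\colon X\to X'$ with $f(K)\in\mathscr C'$ and $f|_K\colon (K,\tau_K)\to (f(K),\tau_{f(K)})$ continuous for all $K\in\mathscr C$. This is the category $\mathbf{Cmp}$; $\mathbf{Cmp}_\kappa$ is the full subcategory of those objects with $|K|<\kappa$ for all $K\in\mathscr C$. A category is regular if it has finite limits, kernel pairs of morphisms have coequalizers, and regular epimorphisms (coequalizers of some parallel pair) are stable under pullback. A category is coregular if its opposite category is regular, i.e. it has finite colimits, cokernel pairs have equalizers, and regular monomorphisms (equalizers of some parallel pair) are stable under pushout. *)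

(* Defs.v *)
From HB Require Import structures.
From mathcomp Require Import all_boot.
From mathcomp Require Import boolp classical_sets functions cardinality.
From mathcomp Require Import topology.

Set Implicit Arguments.
Unset Strict Implicit.
Unset Printing Implicit Defensive.

Local Open Scope classical_set_scope.
Local Open Scope card_scope.

(** * Categories *)

(* [comp g f] is g after f; morphisms are compared with Leibniz equality. *)
Record category := Category {
  ob :> Type;
  hom : ob -> ob -> Type;
  idm : forall x, hom x x;
  comp : forall x y z, hom y z -> hom x y -> hom x z;
  comp1m : forall x y (f : hom x y), comp (idm y) f = f;
  compm1 : forall x y (f : hom x y), comp f (idm x) = f;
  compA : forall x y z w (h : hom z w) (g : hom y z) (f : hom x y),
    comp h (comp g f) = comp (comp h g) f }.

Arguments hom {c} _ _.
Arguments idm {c} _.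
Arguments comp {c x y z} _ _.

Notation "g ∘ f" := (comp g f) (at level 40, left associativity).

Definition opposite (C : category) : category :=
  {| ob := C;
     hom := fun x y => @hom C y x;
     idm := fun x => idm x;
     comp := fun x y z g f => f ∘ g;
     comp1m := fun x y f => compm1 f;
     compm1 := fun x y f => comp1m f;
     compA := fun x y z w h g f => esym (compA f g h) |}.

Definition full_subcategory (C : category) (P : C -> Prop) : category :=
  {| ob := {x : C | P x};
     hom := fun x y => hom (proj1_sig x) (proj1_sig y);
     idm := fun x => idm (proj1_sig x);
     comp := fun x y z g f => g ∘ f;
     comp1m := fun x y f => comp1m f;
     compm1 := fun x y f => compm1 f;
     compA := fun x y z w h g f => compA h g f |}.

Record functor (C D : category) := Functor {
  fobj :> C -> D;
  fmor : forall x y : C, hom x y -> hom (fobj x) (fobj y);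
  fmor1 : forall x : C, fmor (idm x) = idm (fobj x);
  fmorM : forall (x y z : C) (g : hom y z) (f : hom x y),
    fmor (g ∘ f) = fmor g ∘ fmor f }.

(* [finite_set] is not used here because [set: J] would force the objects of a
   category, hence of all categories, into the universe of [set]. *)
Definition finite_type (T : Type) := exists (n : nat) (e : 'I_n -> T), bijective e.

Definition finite_category (J : category) :=
  finite_type J /\ forall x y : J, finite_type (hom x y).

Section Limits.
Variable C : category.

Definition is_cone (J : category) (F : functor J C) (L : C)
    (p : forall j, hom L (F j)) :=
  forall (i j : J) (a : hom i j), fmor F a ∘ p i = p j.

Definition is_limit (J : category) (F : functor J C) (L : C)
    (p : forall j, hom L (F j)) :=
  is_cone p /\
  forall (Z : C) (q : forall j, hom Z (F j)), is_cone q ->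
    exists! u : hom Z L, forall j, p j ∘ u = q j.

Definition has_finite_limits :=
  forall (J : category) (F : functor J C), finite_category J ->
    exists (L : C) (p : forall j, hom L (F j)), is_limit p.

Definition is_pullback (X Y S P : C) (f : hom X S) (g : hom Y S)
    (p : hom P X) (q : hom P Y) :=
  f ∘ p = g ∘ q /\
  forall (Z : C) (a : hom Z X) (b : hom Z Y), f ∘ a = g ∘ b ->
    exists! u : hom Z P, p ∘ u = a /\ q ∘ u = b.

Definition is_kernel_pair (X Y P : C) (f : hom X Y) (p1 p2 : hom P X) :=
  is_pullback f f p1 p2.

Definition is_coequalizer (X Y Q : C) (f g : hom X Y) (q : hom Y Q) :=
  q ∘ f = q ∘ g /\
  forall (Z : C) (h : hom Y Z), h ∘ f = h ∘ g ->
    exists! u : hom Q Z, u ∘ q = h.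

Definition regular_epi (Y Q : C) (q : hom Y Q) :=
  exists (X : C) (f g : hom X Y), is_coequalizer f g q.

Definition kernel_pairs_have_coequalizers :=
  forall (X Y P : C) (f : hom X Y) (p1 p2 : hom P X),
    is_kernel_pair f p1 p2 ->
    exists (Q : C) (q : hom X Q), is_coequalizer p1 p2 q.

Definition regular_epis_stable_under_pullback :=
  forall (X Y S P : C) (f : hom X S) (g : hom Y S) (p : hom P X) (q : hom P Y),
    is_pullback f g p q -> regular_epi g -> regular_epi p.

Definition regular :=
  [/\ has_finite_limits,
      kernel_pairs_have_coequalizers &
      regular_epis_stable_under_pullback].

End Limits.

Definition coregular (C : category) := regular (opposite C).

(** * Topologies *)

Record topology (T : Type) := Topology {
  opens :> set (set T);
  opens_setT : opens setT;
  opens_setI : setI_closed opens;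
  opens_bigcup : forall S : set (set T), S `<=` opens ->
    opens (\bigcup_(A in S) A) }.

(* [space tau] is the set [T] viewed as a [topologicalType] through [tau];
   the choice structure, required by [topologicalType], is irrelevant. *)
Definition space (T : Type) (tau : topology T) : Type := T.

Section Space.
Variables (T : Type) (tau : topology T).

HB.instance Definition _ := gen_eqMixin (space tau).
HB.instance Definition _ := gen_choiceMixin (space tau).

Let opens_bigU (I : Type) (f : I -> set (space tau)) :
  (forall i, opens tau (f i)) -> opens tau (\bigcup_i f i).
Proof.
move=> fo; have -> : \bigcup_i f i = \bigcup_(A in range f) A.
  by rewrite bigcup_image.
by apply: opens_bigcup => _ [i _ <-].
Qed.

HB.instance Definition _ := isOpenTopological.Build (space tau)
  (@opens_setT T tau) (@opens_setI T tau) opens_bigU.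

End Space.

Lemma open_spaceE (T : Type) (tau : topology T) (U : set (space tau)) :
  open U = opens tau U.
Proof. by []. Qed.

(** * Compactological sets *)

(* The map K -> L between subsets induced by [f]. *)
Definition restrict (X Y : Type) (K : set X) (L : set Y) (f : X -> Y)
    (fKL : forall x, K x -> L (f x)) (x : K) : L :=
  exist _ (f (val x)) (mem_set (fKL _ (set_mem (valP x)))).

Record cmpSet := CmpSet {
  carrier :> Type;
  compactology : set (set carrier);
  tau : forall K : set carrier, compactology K -> topology K;
  compactology_nonempty : compactology !=set0;
  tau_compact : forall K (CK : compactology K),
    compact [set: space (tau CK)] /\ hausdorff_space (space (tau CK));
  compactology_cover : \bigcup_(K in compactology) K = setT;
  compactology_directed : forall K1 K2,
    compactology K1 -> compactology K2 ->
    exists2 K3, compactology K3 & K1 `|` K2 `<=` K3;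
  tau_restrict : forall K1 K2 (CK1 : compactology K1) (CK2 : compactology K2)
    (K21 : K2 `<=` K1),
    opens (tau CK2) =
    [set restrict (f := id) K21 @^-1` U | U in opens (tau CK1)];
  (* a subset of the type [K1] is turned into a subset of X by [set_val] *)
  compactology_compact : forall K1 (CK1 : compactology K1)
    (L : set (space (tau CK1))),
    compact L -> compactology [set set_val x | x in (L : set K1)] }.

Definition cmp_morphism (X Y : cmpSet) (f : X -> Y) :=
  forall K (CK : compactology K), exists CfK : compactology (f @` K),
    continuous (restrict (@imageP _ _ f K) : space (tau CK) -> space (tau CfK)).

Record cmpHom (X Y : cmpSet) := CmpHom {
  cmpfun :> X -> Y;
  cmpfunP : cmp_morphism cmpfun }.

Lemma cmpHom_eq (X Y : cmpSet) (f g : cmpHom X Y) : f =1 g -> f = g.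
Proof.
case: f g => [f fP] [g gP] /= /funext fg; case: _ / fg in gP *.
by congr CmpHom; exact: Prop_irrelevance.
Qed.

(* [cmp_morphism] with the image [f @` K] replaced by a propositionally equal
   set [L]. *)
Lemma cmp_morphism_eqimage (X Y : cmpSet) (f : X -> Y) K
    (CK : compactology K) L (CL : compactology L) (fKL : forall x, K x -> L (f x)) :
  L = f @` K ->
  cmp_morphism f ->
  continuous (restrict fKL : space (tau CK) -> space (tau CL)).
Proof.
move=> eL /(_ _ CK); subst L => -[CfK].
by rewrite (Prop_irrelevance CL CfK) (Prop_irrelevance fKL (@imageP _ _ f K)).
Qed.

Lemma cmp_morphism_id (X : cmpSet) : cmp_morphism (@id X).
Proof.
move=> K CK.
have CiK : compactology (id @` K) by rewrite image_id.
exists CiK; move: CiK (@imageP _ _ id K); rewrite image_id => CiK idK.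
rewrite (Prop_irrelevance CiK CK).
suff -> : restrict idK = id by move=> x; exact: cvg_id.
by apply/funext => x; exact/val_inj.
Qed.

Lemma cmp_morphism_comp (X Y Z : cmpSet) (g : Y -> Z) (f : X -> Y) :
  cmp_morphism g -> cmp_morphism f -> cmp_morphism (g \o f).
Proof.
move=> gP fP K CK.
have [CfK fc] := fP K CK; have [CgfK _] := gP _ CfK.
have CK' : compactology ((g \o f) @` K) by rewrite -image_comp.
exists CK'.
have gfK y : (f @` K) y -> ((g \o f) @` K) (g y).
  by move=> [x Kx <-]; exists x.
have gc := @cmp_morphism_eqimage _ _ g _ CfK _ CK' gfK
  (esym (image_comp f g K)) gP.
set h := restrict _.
have -> : h = restrict gfK \o restrict (@imageP _ _ f K).
  by apply/funext => x; exact/val_inj.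
move=> x; exact: (@continuous_comp (space (tau CK)) (space (tau CfK))
  (space (tau CK')) _ _ x (fc x) (gc _)).
Qed.

Definition cmpHom_id (X : cmpSet) := CmpHom (@cmp_morphism_id X).

Definition cmpHom_comp (X Y Z : cmpSet) (g : cmpHom Y Z) (f : cmpHom X Y) :=
  CmpHom (cmp_morphism_comp (cmpfunP g) (cmpfunP f)).

Definition Cmp : category.
Proof.
refine (@Category cmpSet cmpHom cmpHom_id cmpHom_comp _ _ _);
  abstract by move=> *; exact: cmpHom_eq.
Defined.

(** * Cardinals *)

(* A type [kappa] stands for its cardinality. *)

Definition card_lt (T U : Type) (A : set T) (B : set U) :=
  (A #<= B) && ~~ (B #<= A).

Definition uncountable (kappa : Type) := ~ countable [set: kappa].

(* 2 ^ lambda < kappa for all lambda < kappa; every cardinal lambda < kappa is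
   that of some subset of [kappa], which avoids bounding the universe over
   which lambda ranges. *)
Definition strong_limit (kappa : Type) :=
  forall A : set kappa, card_lt A [set: kappa] ->
    card_lt [set B | B `<=` A] [set: kappa].

Definition is_kappa_compactological (kappa : Type) (X : cmpSet) :=
  forall K : set X, compactology K -> card_lt K [set: kappa].

Definition Cmp_kappa (kappa : Type) : category :=
  @full_subcategory Cmp (is_kappa_compactological kappa).

(* Main.v *)
From HB Require Import structures.
From mathcomp Require Import all_boot.
From mathcomp Require Import boolp classical_sets functions cardinality.
From mathcomp Require Import topology.
From Stdlib Require Eqdep.
Require Import Defs.

(** The axioms force the closed subsets of a member [K] of a compactology to be
exactly the members contained in [K], so a compactological set is just a set
with a suitable family of "compact" subsets, and a map [f] is a morphism iff
[f(K)] and [K ∩ f^-1(L)] are compact for all compact [K] and [L].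

In these terms, the quotient of [X] by an equivalence relation exists as soon
as saturations of compact sets meet compact sets in compact sets, and a tube
argument shows that closed relations, in particular intersections of kernels of
morphisms, have this property; together with finite sums this gives finite
colimits.  Regular monomorphisms are the injections along which preimages of
compact sets are compact.  For such an [i : A -> X] and any [h : A -> B] the
equivalence relation on [X + B] that glues [i a] to [h a] is explicit, its
saturations are visibly compact, and [B -> X +_A B] is again of this kind; gluing
[X] to itself along [A] exhibits [i] as an equalizer.

All constructions are subobjects, quotients or finite sums, hence preserve the
bound [|K| < kappa]. *)

Set Implicit Arguments.
Unset Strict Implicit.
Unset Printing Implicit Defensive.

Local Open Scope classical_set_scope.
Local Open Scope card_scope.

(** * Compactological sets as families of compact sets *)

Definition down_directed (T : Type) (S : set (set T)) :=
  forall A B, S A -> S B -> exists2 D, S D & D `<=` A `&` B.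

(** [fam_compact] is compactness in finite intersection form; [fam_sep] is the Hausdorff axiom, with
    [A] and [B] the closed complements of two disjoint neighbourhoods in [K]. *)
Record compact_family (T : Type) (C : set (set T)) : Prop := CompactFamily {
  fam1 : forall x, C [set x];
  fam0 : C set0;
  famU : setU_closed C;
  fam_bigI : forall S, S `<=` C -> S !=set0 -> C (\bigcap_(A in S) A);
  fam_compact : forall S, S `<=` C -> S !=set0 -> down_directed S -> ~ S set0 ->
    \bigcap_(A in S) A !=set0;
  fam_sep : forall K x y, C K -> K x -> K y -> x <> y ->
    exists A B, [/\ C A, C B, K `<=` A `|` B, ~ A x & ~ B y] }.

Lemma famI (T : Type) (C : set (set T)) : compact_family C -> setI_closed C.
Proof.
move=> CC A B CA CB.
have -> : A `&` B = \bigcap_(D in [set A; B]) D.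
  apply/seteqP; split=> [x [Ax Bx] _ [->|->]//|x ABx].
  by split; apply: ABx; [left|right].
by apply: (fam_bigI CC) => [_ [->|->]//|]; exists A; left.
Qed.

(** * Members of a compactology as closed sets *)

Section Trace.
Variables (X : cmpSet) (K : set X) (CK : compactology K).

Definition trace (A : set X) : set (space (tau CK)) :=
  [set x | A (val (x : K))].

Lemma image_trace A : A `<=` K -> [set set_val x | x in (trace A : set K)] = A.
Proof.
move=> AK; apply/seteqP; split=> [_ [x Ax <-]//|x Ax].
by exists (SigSub (mem_set (AK _ Ax))).
Qed.

(** A closed subset of [K] is compact, hence a member. Conversely a member [A] is compact for its
    own topology and its inclusion into [K] is continuous by [tau_restrict], so its image in the
    Hausdorff space [K] is closed. *)
Lemma closed_traceP A : A `<=` K -> closed (trace A) <-> compactology A.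
Proof.
move=> AK; have [Kc Kh] := tau_compact CK; split=> [Acl|CA].
  rewrite -(image_trace AK); apply: compactology_compact.
  exact: (subclosed_compact Acl Kc).
apply: compact_closed => //.
have [Ac _] := tau_compact CA.
pose i : space (tau CA) -> space (tau CK) := restrict (f := id) AK.
have -> : trace A = i @` setT.
  apply/seteqP; split=> [x Ax|_ [x _ <-]].
    by exists (SigSub (mem_set (Ax : A (val (x : K))))) => //; exact/val_inj.
  exact: set_mem (valP (x : A)).
apply: continuous_compact => //; apply: continuous_subspaceT.
apply/continuousP => U oU.
by rewrite open_spaceE (tau_restrict CK CA AK); exists U.
Qed.

End Trace.
Arguments trace {X K} CK A.

Lemma compactologyP (X : cmpSet) : compact_family (@compactology X).
Proof.
have C1 (x : X) : compactology [set x].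
  have [K CK Kx] : (\bigcup_(K in @compactology X) K) x.
    by rewrite compactology_cover.
  have xK : [set x] `<=` K by move=> _ ->.
  rewrite -(image_trace CK xK); apply: compactology_compact.
  have -> : trace CK [set x] = [set SigSub (mem_set Kx)].
    by apply/seteqP; split=> [y /= yx|_ ->//]; exact/val_inj.
  exact: compact_set1.
have CU : setU_closed (@compactology X).
  move=> A B CA CB; have [K CK ABK] := compactology_directed CA CB.
  apply/(closed_traceP CK ABK).
  apply: (@closedU _ (trace CK A) (trace CK B)); apply/closed_traceP => //.
    by move=> x Ax; apply: ABK; left.
  by move=> x Bx; apply: ABK; right.
have C0 : compactology (set0 : set X).
  have [K CK] := compactology_nonempty X.
  apply/(closed_traceP CK (sub0set K)); exact: closed0.
have Cb (S : set (set X)) : S `<=` @compactology X -> S !=set0 ->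
    compactology (\bigcap_(A in S) A).
  move=> SC [K SK]; have CK := SC _ SK.
  have bK : \bigcap_(A in S) A `<=` K by move=> x; exact.
  apply/(closed_traceP CK bK).
  have -> : trace CK (\bigcap_(A in S) A) = \bigcap_(A in S) trace CK (A `&` K).
    apply/seteqP; split=> x Sx A SA; last by case: (Sx A SA).
    by split; [exact: Sx|exact: set_mem (valP (x : K))].
  (* [A] need not lie in [K], but both are closed in their union, which is a member; so their
     intersection is a member and closed in [K]. *)
  apply: closed_bigI => A SA; have CAK := CU _ _ (SC _ SA) CK.
  have AAK : A `<=` A `|` K by left.
  have KAK : K `<=` A `|` K by right.
  apply/closed_traceP; first by move=> x [].
  have AKK : A `&` K `<=` A `|` K by move=> x [Ax _]; left.
  apply/(closed_traceP CAK AKK).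
  by apply: (@closedI _ (trace CAK A) (trace CAK K)); apply/closed_traceP => //;
    exact: SC.
split=> //.
  move=> S SC [K SK] Sd S0; have CK := SC _ SK.
  (* A cluster point of this filter lies in the closed trace of every [D] in [S] contained in [K],
     and by directedness each [A] in [S] contains such a [D]. *)
  pose F : set_system (space (tau CK)) := filter_from S (trace CK).
  have FF : ProperFilter F.
    apply: filter_from_proper; first apply: filter_from_filter.
    - by exists K.
    - by move=> A B /Sd SA /SA [D SD DAB]; exists D => // x /DAB.
    move=> A SA; have [D SD DAK] := Sd _ _ SA SK.
    have [x Dx] : D !=set0 by apply/set0P/eqP => D0; apply: S0; rewrite -D0.
    by have [Ax Kx] := DAK _ Dx; exists (SigSub (mem_set Kx)).
  have [Kc _] := tau_compact CK.
  have [|x [_ xF]] := Kc F FF; first exact: filterT.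
  exists (val (x : K)) => A SA; have [D SD DAK] := Sd _ _ SA SK.
  have DK : D `<=` K by move=> y /DAK [].
  suff /DAK[] : D (val (x : K)) by [].
  have /(_ x) := (closed_traceP CK DK).2 (SC _ SD); apply => B xB.
  by apply: xF => //; exists D.
move=> K x y CK Kx Ky xy; have [_] := tau_compact CK.
rewrite open_hausdorff.
move=> /(_ (SigSub (mem_set Kx)) (SigSub (mem_set Ky))) [].
  by apply/eqP => /(congr1 val).
move=> [U V] /= [/set_mem Ux /set_mem Vy] [oU oV /eqP UV].
pose co (W : set (space (tau CK))) := [set val (z : K) | z in ~` W].
have coC W : open W -> compactology (co W).
  move=> oW; have cK : co W `<=` K.
    by move=> _ [z _ <-]; exact: set_mem (valP (z : K)).
  apply/(closed_traceP CK cK).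
  suff -> : trace CK (co W) = ~` W by exact: open_closedC.
  by apply/seteqP; split=> [z [w Ww /val_inj <-]|z Wz]//; exists z.
exists (co U), (co V); split; try exact: coC.
- move=> z Kz; pose z' : space (tau CK) := SigSub (mem_set Kz).
  have [Uz|Uz] := pselect (U z'); last by left; exists z'.
  right; exists z' => // Vz.
  by have : (U `&` V) z' by []; rewrite UV.
- by move=> [z Uz] zx; apply: Uz; rewrite (_ : z = SigSub (mem_set Kx)) //; exact/val_inj.
- by move=> [z Uz] zx; apply: Uz; rewrite (_ : z = SigSub (mem_set Ky)) //; exact/val_inj.
Qed.

(** * The compactological set of a compact family *)

Section OfFamily.
Variables (T : Type) (C : set (set T)) (CC : compact_family C).

Section Topology.
Variables (K : set T) (CK : C K).

Let opens_fam : set (set K) := [set U | C [set val x | x in ~` U]].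

Let opens_famT : opens_fam setT.
Proof.
rewrite /opens_fam /= setCT image_set0; exact: fam0 CC.
Qed.

Let opens_famI : setI_closed opens_fam.
Proof.
by move=> U V; rewrite /opens_fam /= setCI image_setU; exact: famU.
Qed.

Let opens_fam_bigcup (S : set (set K)) :
  S `<=` opens_fam -> opens_fam (\bigcup_(U in S) U).
Proof.
move=> So; have [->|S0] := eqVneq S set0.
  rewrite /opens_fam /= bigcup_set0 setC0.
  suff -> : [set val x | x in [set: K]] = K by [].
  apply/seteqP; split=> [_ [x _ <-]|x Kx]; first exact: set_mem (valP x).
  by exists (SigSub (mem_set Kx)).
pose S' := [set [set val x | x in ~` U] | U in S].
have -> : opens_fam (\bigcup_(U in S) U) = C (\bigcap_(A in S') A).
  congr C; apply/seteqP; split=> [_ [x Sx <-] _ [U SU <-]|x Sx].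
    by exists x => // Ux; apply: Sx; exists U.
  have /set0P[U SU] := S0.
  have [|y Uy yx] := Sx [set val x | x in ~` U]; first by exists U.
  exists y => // -[V SV Vy].
  have [|z Vz zx] := Sx [set val x | x in ~` V]; first by exists V.
  by apply: Vz; rewrite (_ : z = y)//; apply/val_inj; rewrite zx yx.
apply: fam_bigI => // [_ [U SU <-]|]; first exact: So.
by have /set0P[U SU] := S0; exists [set val x | x in ~` U], U.
Qed.

Definition family_topology : topology K :=
  Topology opens_famT opens_famI opens_fam_bigcup.

Lemma closed_family (A : set (space family_topology)) :
  closed A <-> C [set val (x : K) | x in A].
Proof. by rewrite -openC open_spaceE /= /opens_fam /= setCK. Qed.

Lemma family_topology_compact : compact [set: space family_topology].
Proof.
move=> F FF _; pose im (A : set (space family_topology)) : set T :=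
  [set val x | x in (closure A : set K)].
(* Closures of sets of the filter are non-empty members and form a down-directed family; a common
   point is a cluster point. *)
pose S := im @` F.
have [|||S0|x Sx] := fam_compact CC (S := S).
- by move=> _ [A _ <-]; apply/closed_family; exact: closed_closure.
- by exists (im setT), setT => //; exact: filterT.
- move=> _ _ [A FA <-] [B FB <-].
  exists (im (A `&` B)).
    by exists (A `&` B) => //; exact: filterI.
  by move=> _ [x /closureI[Ax Bx] <-]; split; exists x.
- case: S0 => A FA A0; have [x Ax] := filter_ex FA.
  suff : (set0 : set T) (val (x : K)) by [].
  by rewrite -A0; exists x => //; exact: subset_closure.
have [|y _ yx] := Sx (im setT).
  by exists setT => //; exact: filterT.
exists y; split=> //; rewrite clusterE => A FA.
have [|z zA zx] := Sx (im A); first by exists A.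
by rewrite (_ : y = z)//; apply/val_inj; rewrite yx zx.
Qed.

Lemma family_topology_hausdorff : hausdorff_space (space family_topology).
Proof.
rewrite open_hausdorff => x y /eqP xy.
have Kv (z : space family_topology) : K (val (z : K)).
  exact: set_mem (valP (z : K)).
have [|A [B [CA CB KAB Ax By]]] := fam_sep CC CK (Kv x) (Kv y).
  by move=> /val_inj.
pose co A := [set z : space family_topology | ~ A (val (z : K))].
have co_open D : C D -> open (co D).
  move=> CD; rewrite open_spaceE /= /opens_fam /=.
  suff -> : [set val (z : K) | z in ~` (co D)] = K `&` D by exact: famI.
  apply/seteqP; split=> [_ [z /contrapT Dz <-]|z [Kz Dz]]; first by split.
  by exists (SigSub (mem_set Kz)) => // /(_ Dz).
exists (co A, co B) => /=; first by split; apply/mem_set.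
split; try exact: co_open.
by apply/eqP/seteqP; split=> // z [Az Bz]; case: (KAB _ (Kv z)).
Qed.

End Topology.

Definition cmp_of_family : cmpSet.
Proof.
refine (@CmpSet T C family_topology _ _ _ _ _ _).
- by exists set0; exact: fam0 CC.
- by move=> K CK; split; [exact: family_topology_compact
                         |exact: family_topology_hausdorff].
- apply/seteqP; split=> // x _; exists [set x] => //; exact: fam1 CC x.
- by move=> K1 K2 CK1 CK2; exists (K1 `|` K2) => //; exact: famU.
- move=> K1 K2 CK1 CK2 K21; apply/seteqP; split=> [U|_ [U CU <-]] /=.
    (* The complement [D] of an open set [U] of [K2] is a member that also lies in [K1], so its
       complement in [K1] is open and restricts to [U]. *)
    move=> CU; pose D := [set val x | x in ~` U].
    exists [set z : K1 | ~ D (val z)].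
      rewrite /=; suff -> : [set val x | x in ~` [set z : K1 | ~ D (val z)]] = D.
        by [].
      apply/seteqP; split=> [_ [z /contrapT Dz <-]//|z Dz].
      have Kz : K1 z by case: Dz => w _ <-; apply: K21; exact: set_mem (valP w).
      by exists (SigSub (mem_set Kz)) => // /(_ Dz).
    apply/seteqP; split=> z /=; last by move=> Uz [w Uw /val_inj wz]; rewrite -wz in Uz.
    by move=> Dz; apply: contrapT => Uz; apply: Dz; exists z.
  rewrite /=; set D := [set _ | _ in _]; suff -> : D = K2 `&` [set val x | x in ~` U].
    exact: famI.
  apply/seteqP; split=> [_ [z Uz <-]|z [Kz [w Uw wz]]].
    split; first exact: set_mem (valP z).
    by exists (restrict (f := id) K21 z).
  exists (SigSub (mem_set Kz)) => //= Uz; apply: Uw.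
  by move: Uz; congr U; exact/val_inj.
- move=> K CK L Lc; apply: (closed_family (CK := CK) L).1.
  by apply: compact_closed => //; exact: family_topology_hausdorff.
Defined.

End OfFamily.

(** Continuity is tested on closed sets, which are the members contained in [K] and in its image; a
    general [L] is first intersected with the image. *)
Lemma cmp_morphismP (X Y : cmpSet) (f : X -> Y) :
  cmp_morphism f <->
  (forall K, compactology K -> compactology (f @` K)) /\
  (forall K L, compactology K -> compactology L ->
     compactology (K `&` f @^-1` L)).
Proof.
split=> [fP|[fK fL] K CK].
  split=> [K /fP[]//|K L CK CL]; have [CfK fc] := fP K CK.
  have KfK : K `&` f @^-1` L `<=` K by move=> x [].
  apply/(closed_traceP CK KfK).
  have LfK : f @` K `&` L `<=` f @` K by move=> x [].
  have := (closed_traceP CfK LfK).2 (famI (compactologyP Y) CfK CL).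
  move/continuous_closedP: fc => /[apply].
  congr closed; apply/seteqP; split=> x [xL fx]; split=> //.
    exact: set_mem (valP (x : K)).
  by exists (val (x : K)).
exists (fK K CK); apply/continuous_closedP => A Acl.
pose A' := [set val (z : f @` K) | z in A].
have A'K : A' `<=` f @` K by move=> _ [z _ <-]; exact: set_mem (valP (z : f @` K)).
have eA : A = trace (fK K CK) A'.
  by apply/seteqP; split=> [z Az|z [w Aw /val_inj <-]//]; exists z.
have CA' : compactology A' by apply/(closed_traceP (fK K CK) A'K); rewrite -eA.
have KA : K `&` f @^-1` A' `<=` K by move=> x [].
have := (closed_traceP CK KA).2 (fL _ _ CK CA').
congr closed; rewrite eA; apply/seteqP; split=> x; first by case.
by move=> Ax; split=> //; exact: set_mem (valP (x : K)).
Qed.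

Lemma hom_image (X Y : cmpSet) (f : cmpHom X Y) K :
  compactology K -> compactology (f @` K).
Proof. by have /cmp_morphismP[fK _] := cmpfunP f; exact: fK. Qed.

Lemma hom_preimage (X Y : cmpSet) (f : cmpHom X Y) K L :
  compactology K -> compactology L -> compactology (K `&` f @^-1` L).
Proof. by have /cmp_morphismP[_ fL] := cmpfunP f; exact: fL. Qed.

Lemma cmpHom_ex (X Y : cmpSet) (f : X -> Y) :
  (forall K, compactology K -> compactology (f @` K)) ->
  (forall K L, compactology K -> compactology L ->
     compactology (K `&` f @^-1` L)) ->
  exists h : cmpHom X Y, forall x, h x = f x.
Proof. by move=> fK fL; exists (CmpHom ((cmp_morphismP f).2 (conj fK fL))). Qed.

(** * Separation of compact sets *)

Section Separation.
Variables (T : Type) (C : set (set T)) (CC : compact_family C).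

(** If every [B] in [I] met [G], the traces on [G] would form a down-directed family of non-empty
    members, and [fam_compact] would give a point of [G] lying in all of [I]. This is the
    compactness step of each tube argument. *)
Lemma compact_avoid (I : set (set T)) (G : set T) :
  I `<=` C -> I !=set0 -> setI_closed I -> C G ->
  (forall y, G y -> exists2 B, I B & ~ B y) ->
  exists2 B, I B & B `&` G = set0.
Proof.
move=> IC [B0 IB0] II CG GI; pose S := [set B `&` G | B in I].
have [[B IB BG]|S0] := pselect (S set0); first by exists B.
have [|||//|y Sy] := fam_compact CC (S := S).
- by move=> _ [B IB <-]; apply: famI => //; exact: IC.
- by exists (B0 `&` G), B0.
- move=> _ _ [A IA <-] [B IB <-]; exists (A `&` B `&` G).
    by exists (A `&` B) => //; exact: II.
  by move=> x [[Ax Bx] Gx].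
have [|_ Gy] := Sy (B0 `&` G); first by exists B0.
have [B IB By] := GI y Gy.
by have [|] := Sy (B `&` G); first by exists B.
Qed.

(** This is normality of compact Hausdorff spaces: [compact_avoid] passes from points to all of [G]
    for a fixed point of [F], and then from points to all of [F]. *)
Lemma compact_separated K F G : C K -> C F -> C G -> F `<=` K -> G `<=` K ->
  F `&` G = set0 ->
  exists A B, [/\ C A, C B, K `<=` A `|` B, A `&` F = set0 & B `&` G = set0].
Proof.
move=> CK CF CG FK GK FG.
have point x : F x -> exists A B,
    [/\ C A, C B, K `<=` A `|` B, ~ A x & B `&` G = set0].
  move=> Fx.
  (* The candidates [B] are those completed to a cover of [K] by some [A] missing [x]; when two of
     them are intersected, the corresponding sets [A] are united. *)
  have [||||y Gy|B [CB [A [CA KAB Ax]]] BG] := @compact_avoid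
      [set B | C B /\ exists A, [/\ C A, K `<=` A `|` B & ~ A x]] G.
  - by move=> B [].
  - exists K; split=> //; exists set0; split=> //; first exact: fam0.
  - move=> B B' [CB [A [CA KAB Ax]]] [CB' [A' [CA' KAB' Ax']]].
    split; first exact: famI.
    exists (A `|` A'); split; [exact: famU| |by case].
    move=> z Kz; have [Az|Bz] := KAB _ Kz; first by left; left.
    by have [Az|Bz'] := KAB' _ Kz; [left; right|right].
  - exact: CG.
  - have xy : x <> y by move=> xy; suff : (set0 : set T) y by []; rewrite -FG; split=> //; rewrite -xy.
    have [A [B [CA CB KAB Ax By]]] := fam_sep CC CK (FK _ Fx) (GK _ Gy) xy.
    by exists B => //; split=> //; exists A.
  - by exists A, B.
have [||||x Fx|A [CA [B [CB KAB BG]]] AF] := @compact_avoid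
    [set A | C A /\ exists B, [/\ C B, K `<=` A `|` B & B `&` G = set0]] F.
- by move=> A [].
- exists K; split=> //; exists set0; split; first exact: fam0.
    by move=> z Kz; left.
  by rewrite set0I.
- move=> A A' [CA [B [CB KAB BG]]] [CA' [B' [CB' KAB' BG']]].
  split; first exact: famI.
  exists (B `|` B'); split; first exact: famU.
    move=> z Kz; have [Az|Bz] := KAB _ Kz; last by right; left.
    by have [Az'|Bz] := KAB' _ Kz; [left|right; right].
  by rewrite setIUl BG BG' setU0.
- exact: CF.
- have [A [B [CA CB KAB Ax BG]]] := point x Fx.
  by exists A => //; split=> //; exists B.
- by exists A, B.
Qed.

(** [E] is the intersection of all members containing it, of which [K] is one. *)
Lemma compact_of_points K E : C K -> E `<=` K ->
  (forall x, K x -> ~ E x -> exists D, [/\ C D, E `<=` D & ~ D x]) -> C E.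
Proof.
move=> CK EK Esep.
have -> : E = \bigcap_(D in [set D | C D /\ E `<=` D]) D.
  apply/seteqP; split=> [x Ex D [_]|x Dx]; first exact.
  have Kx : K x by exact: Dx.
  apply: contrapT => Ex; have [D [CD ED]] := Esep x Kx Ex.
  by apply; exact: Dx.
by apply: (fam_bigI CC) => [D []//|]; exists K.
Qed.

End Separation.

(** * Subobjects, quotients and finite sums *)

Section Induced.
Variables (X : cmpSet) (T : Type) (i : T -> X) (inj_i : injective i).

Lemma induced_family : compact_family [set K | compactology (i @` K)].
Proof.
have CX := compactologyP X; split=> /=.
- by move=> x; rewrite image_set1; exact: fam1.
- by rewrite image_set0; exact: fam0.
- by move=> A B; rewrite /= image_setU; exact: famU.
- move=> S SC [K SK] /=.
  have -> : i @` (\bigcap_(A in S) A) = \bigcap_(B in [set i @` A | A in S]) B.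
    apply/seteqP; split=> [_ [x Sx <-] _ [A SA <-]|y Sy].
      by exists x => //; exact: Sx.
    have [|x _ xy] := Sy (i @` K); first by exists K.
    exists x => // A SA; have [|z Az] := Sy (i @` A); first by exists A.
    by rewrite -xy => /inj_i <-.
  apply: fam_bigI => // [_ [A SA <-]|]; first exact: SC.
  by exists (i @` K), K.
- move=> S SC [K SK] Sd S0.
  have [||_ _ [A SA <-] [B SB <-]||y Sy] := fam_compact CX (S := [set i @` A | A in S]).
  + by move=> _ [A SA <-]; exact: SC.
  + by exists (i @` K), K.
  + have [D SD DAB] := Sd _ _ SA SB; exists (i @` D); first by exists D.
    by move=> _ [x /DAB[Ax Bx] <-]; split; exists x.
  + by move=> [A SA /image_set0_set0 A0]; rewrite A0 in SA.
  + have [|x Kx xy] := Sy (i @` K); first by exists K.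
    exists x => A SA; have [|z Az] := Sy (i @` A); first by exists A.
    by rewrite -xy => /inj_i <-.
- move=> K x y CK Kx Ky xy.
  have [||//|A [B [CA CB KAB Ax By]]] := fam_sep CX (x := i x) (y := i y) CK.
  + by exists x.
  + by exists y.
  + by move=> /inj_i.
  (* The separating members are cut down to the image of [K], so that they are images of subsets of
     [T]. *)
  have im D : i @` (i @^-1` (D `&` i @` K)) = D `&` i @` K.
    apply/seteqP; split=> [_ [z Dz <-]//|y' [Dy [z Kz zy]]].
    by exists z => //=; rewrite zy; split=> //; exists z.
  exists (i @^-1` (A `&` i @` K)), (i @^-1` (B `&` i @` K)); rewrite /= !im.
  split; [exact: famI|exact: famI| |by case|by case].
  by move=> z Kz; have [||] := KAB (i z); [by exists z|left; split|right; split];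
    try (by exists z).
Qed.

Definition induced : cmpSet := cmp_of_family induced_family.

Lemma induced_incl : exists e : cmpHom induced X, forall x, e x = i x.
Proof.
apply: (@cmpHom_ex induced X) => // K L CK CL.
change (compactology (i @` (K `&` i @^-1` L))).
have -> : i @` (K `&` i @^-1` L) = i @` K `&` L.
  apply/seteqP; split=> [_ [x [Kx Lx] <-]|_ [[x Kx <-] Lx]].
    by split=> //; exists x.
  by exists x.
exact: famI (compactologyP X) _ _ CK CL.
Qed.

Lemma induced_lift (Z : cmpSet) (f : cmpHom Z X) (u : Z -> T) :
  (forall z, i (u z) = f z) -> exists h : cmpHom Z induced, forall z, h z = u z.
Proof.
move=> iu; have fE : i \o u = f by apply/funext.
apply: (@cmpHom_ex Z induced) => [K CK|K L CK CL].
  by change (compactology (i @` (u @` K))); rewrite image_comp fE; exact: hom_image.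
suff -> : K `&` u @^-1` L = K `&` f @^-1` (i @` L) by exact: hom_preimage.
apply/seteqP; split=> [z [Kz Lz]|z [Kz [t Lt tz]]]; split=> //.
  by exists (u z).
by rewrite /=; have /inj_i <- : i t = i (u z) by rewrite iu.
Qed.

End Induced.

(** * Quotients with compact saturations *)

Section Quotient.
Variables (X : cmpSet) (T : Type) (r : X -> T).
Hypothesis r_surj : forall t, exists x, r x = t.
Hypothesis r_sat : forall K L, compactology K -> compactology L ->
  compactology (K `&` r @^-1` (r @` L)).

(** A family [S] is lifted to the parts of one fixed compact [K] lying over its sets; these are
    compact by [r_sat], so intersections are controlled in [X]. Distinct points are separated
    through their disjoint compact fibres in [K]. *)
Lemma quotient_family : compact_family [set r @` K | K in @compactology X].
Proof.
have CX := compactologyP X; split=> /=.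
- move=> t; have [x <-] := r_surj t; exists [set x]; first exact: fam1.
  by rewrite image_set1.
- by exists set0; [exact: fam0|rewrite image_set0].
- move=> _ _ [A CA <-] [B CB <-]; exists (A `|` B); first exact: famU.
  by rewrite image_setU.
- move=> S SC [K0 SK]; have [K CK KK0] := SC _ SK; rewrite -{K0}KK0 in SK.
  exists (\bigcap_(A in [set K `&` r @^-1` B | B in S]) A).
    apply: fam_bigI => // [_ [B /SC [L CL <-] <-]|]; first exact: r_sat.
    by exists (K `&` r @^-1` (r @` K)), (r @` K).
  apply/seteqP; split=> [_ [x Sx <-] B SB|t St].
    by have [|] := Sx (K `&` r @^-1` B); first by exists B.
  have [x Kx xt] := St _ SK; exists x => // _ [B SB <-]; split=> //=.
  by rewrite xt; exact: St.
- move=> S SC [K0 SK] Sd S0; have [K CK KK0] := SC _ SK; rewrite -{K0}KK0 in SK.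
  have [||_ _ [A SA <-] [B SB <-]||x Sx] :=
      fam_compact CX (S := [set K `&` r @^-1` B | B in S]).
  + by move=> _ [B /SC [L CL <-] <-]; exact: r_sat.
  + by exists (K `&` r @^-1` (r @` K)), (r @` K).
  + have [D SD DAB] := Sd _ _ SA SB; exists (K `&` r @^-1` D); first by exists D.
    by move=> x [Kx /DAB[Ax Bx]].
  + move=> [A SA A0]; have [D SD DAK] := Sd _ _ SA SK.
    have [t Dt] : D !=set0 by apply/set0P/eqP => D0; rewrite D0 in SD.
    have [At [x Kx xt]] := DAK _ Dt.
    by suff : (set0 : set X) x by []; rewrite -A0; split=> //=; rewrite xt.
  + by exists (r x) => A SA; have [|] := Sx (K `&` r @^-1` A); first by exists A.
- move=> _ s t [K CK <-] [x Kx <-] [y Ky <-] xy.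
  have CF z : compactology (K `&` r @^-1` (r @` [set z])).
    by apply: r_sat => //; exact: fam1.
  have [|||A [B [CA CB KAB AF BG]]] := compact_separated CX CK (CF x) (CF y).
  + by move=> z [].
  + by move=> z [].
  + apply/seteqP; split=> // z [[_ [_ -> xz]] [_ [_ -> yz]]].
    by apply: xy; rewrite xz.
  have side z D D' : compactology D -> D `&` (K `&` r @^-1` (r @` [set z])) = set0 ->
      ~ (r @` (K `&` D)) (r z).
    move=> CD D0 [w [Kw Dw] wz].
    suff : (set0 : set X) w by [].
    by rewrite -D0; split=> //; split=> //; exists z.
  exists (r @` (K `&` A)), (r @` (K `&` B)); split.
  + by exists (K `&` A) => //; exact: famI.
  + by exists (K `&` B) => //; exact: famI.
  + by move=> _ [z Kz <-]; have [Az|Bz] := KAB _ Kz; [left|right]; exists z.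
  + exact: side AF.
  + exact: side BG.
Qed.

Definition quotient : cmpSet := cmp_of_family quotient_family.

Lemma quotient_proj : exists q : cmpHom X quotient, forall x, q x = r x.
Proof.
apply: (@cmpHom_ex X quotient) => [K CK|K _ CK [L CL <-]]; first by exists K.
exact: r_sat.
Qed.

Lemma quotient_desc (Z : cmpSet) (h : cmpHom X Z) :
  (forall x y, r x = r y -> h x = h y) ->
  exists u : cmpHom quotient Z, forall x, u (r x) = h x.
Proof.
move=> hr; have [s rs] := choice r_surj.
have hs x : h (s (r x)) = h x by apply: hr.
have [||u uE] := @cmpHom_ex quotient Z (h \o s).
- move=> _ [K CK <-].
  suff -> : (h \o s) @` (r @` K) = h @` K by exact: hom_image.
  by rewrite image_comp; congr (_ @` _); apply/funext => x /=.
- move=> _ L [K CK <-] CL; exists (K `&` h @^-1` L); first exact: hom_preimage.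
  apply/seteqP; split=> [_ [x [Kx Lx] <-]|_ [[x Kx <-]]].
    by split; [exists x|rewrite /= hs].
  by rewrite /= hs => Lx; exists x.
by exists u => x; rewrite uE /= hs.
Qed.

End Quotient.

Lemma finite_bigcup_ind (T : Type) (P : set (set T)) :
  P set0 -> setU_closed P ->
  forall (I : finType) (F : I -> set T), (forall i, P (F i)) -> P (\bigcup_i F i).
Proof.
move=> P0 PU I F PF.
suff Ps (s : seq I) : P (\bigcup_(i in [set i | i \in s]) F i).
  rewrite (_ : [set: I] = [set i | i \in enum I])//.
  by apply/seteqP; split=> i //= _; rewrite mem_enum.
elim: s => [|i s Ps].
  by rewrite (_ : [set _ | _] = set0) ?bigcup_set0//; apply/seteqP; split.
rewrite (_ : [set _ | _] = i |` [set j | j \in s]); last first.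
  apply/seteqP; split=> j /=; rewrite in_cons.
    by move=> /orP[/eqP|]; [left|right].
  by move=> [->|->]; rewrite ?eqxx ?orbT.
by rewrite bigcup_setU1; exact: PU.
Qed.

(** * Finite sums *)

Section Sum.
Variables (I : finType) (X : I -> cmpSet).

Local Notation inS i x := (existT (fun i => carrier (X i)) i x).

Definition fiber (K : set {i & X i}) i : set (X i) := [set x | K (inS i x)].
Arguments fiber K i : clear implicits.

Lemma fiber_image i (A : set (X i)) : fiber [set inS i x | x in A] i = A.
Proof.
by apply/seteqP; split=> [x [y Ay /(@eq_from_Tagged _ _ _ _ _) <-]|x Ax]; last by exists x.
Qed.

Lemma sum_part i (A : set (X i)) :
  compactology A -> forall j, compactology (fiber [set inS i x | x in A] j).
Proof.
move=> CA j; have [->|ji] := eqVneq j i; first by rewrite fiber_image.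
rewrite (_ : fiber _ j = set0); first exact: fam0 (compactologyP _).
by apply/seteqP; split=> // x [y _ [ij _]]; rewrite ij eqxx in ji.
Qed.

Lemma sum_family :
  compact_family [set K | forall i, compactology (fiber K i)].
Proof.
have CX i := compactologyP (X i).
have Cpart := sum_part.
have Coff K i : (forall j, compactology (fiber K j)) ->
    forall j, compactology (fiber [set t | K t /\ tag t != i] j).
  move=> CK j; have [->|ji] := eqVneq j i.
    rewrite (_ : fiber _ i = set0); first exact: fam0.
    by apply/seteqP; split=> // x [_] /=; rewrite eqxx.
  rewrite (_ : fiber _ j = fiber K j)//.
  by apply/seteqP; split=> [x []//|x Kx]; split.
have CU : setU_closed [set K | forall i, compactology (fiber K i)].
  by move=> A B CA CB i; exact: famU (CA i) (CB i).
split=> //=.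
- move=> [i x] j; have := Cpart i [set x] (fam1 (CX i) x) j.
  by rewrite image_set1.
- by move=> i; exact: fam0.
- move=> S SC [K SK] i.
  rewrite (_ : fiber _ i = \bigcap_(A in [set fiber B i | B in S]) A).
    apply: fam_bigI => // [_ [B SB <-]|]; first exact: SC.
    by exists (fiber K i), K.
  apply/seteqP; split=> [x Sx _ [B SB <-]|x Sx B SB]; first exact: Sx.
  by have := Sx (fiber B i); apply; exists B.
- move=> S SC [K SK] Sd S0; apply: contrapT => S00.
  (* If the intersection were empty, each summand would have a set of [S] with empty fibre there; by
     directedness one set of [S] would have all its finitely many fibres empty. *)
  have fib i : exists2 A, S A & fiber A i = set0.
    apply: contrapT => Si; apply: S00.
    have [||_ _ [A SA <-] [B SB <-]||x Sx] :=
        fam_compact (CX i) (S := [set fiber B i | B in S]).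
    + by move=> _ [B SB <-]; exact: SC.
    + by exists (fiber K i), K.
    + have [D SD DAB] := Sd _ _ SA SB; exists (fiber D i); first by exists D.
      by move=> x /DAB[].
    + by move=> [A SA A0]; apply: Si; exists A.
    + exists (inS i x) => A SA.
      by have := Sx (fiber A i); apply; exists A.
  have fibs (s : seq I) : exists2 A, S A & forall i, i \in s -> fiber A i = set0.
    elim: s => [|i s [A SA As]]; first by exists K.
    have [B SB Bi] := fib i; have [D SD DAB] := Sd _ _ SA SB; exists D => // j.
    rewrite in_cons => /orP[/eqP ->|js]; rewrite -subset0.
      by rewrite -Bi => x /DAB[].
    by rewrite -(As _ js) => x /DAB[].
  have [A SA A0] := fibs (enum I); apply: S0.
  suff <- : A = set0 by [].
  apply/seteqP; split=> // -[i x] Ax.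
  suff : fiber A i x by rewrite A0// mem_enum.
  exact: Ax.
- move=> K [i x] [j y] CK Kx Ky xy.
  have [ij|ij] := eqVneq i j.
    subst j.
    have [|A [B [CA CB KAB Ax By]]] := fam_sep (CX i) (CK i) Kx Ky.
      by move=> xy'; apply: xy; rewrite xy'.
    (* Within one summand, a separation of the fibre is completed on both sides by the part of [K]
       in the other summands. *)
    have out (D : set (X i)) z : ~ D z -> ~ ([set inS i x | x in D] `|`
        [set t | K t /\ tag t != i]) (inS i z).
      move=> Dz [|[_]]; last by rewrite /= eqxx.
      have := fiber_image D => /seteqP [DD _].
      by move=> /DD.
    exists ([set inS i x | x in A] `|` [set t | K t /\ tag t != i]),
      ([set inS i x | x in B] `|` [set t | K t /\ tag t != i]).
    split; try by [apply: CU; [exact: Cpart|exact: Coff]|exact: out].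
    move=> [k z] Kz; have [ki|ki] := eqVneq k i; last by left; right.
    by subst k; have [Az|Bz] := KAB _ Kz; [left|right]; left; exists z.
  exists [set t | K t /\ tag t != i], [set inS i x | x in fiber K i].
  split; [exact: Coff|exact: Cpart| | |].
  + move=> [k z] Kz; have [ki|ki] := eqVneq k i; last by left.
    by subst k; right; exists z.
  + by move=> [_] /=; rewrite eqxx.
  + by move=> [z _ [zj _]]; rewrite zj eqxx in ij.
Qed.

Definition cmp_sum : cmpSet := cmp_of_family sum_family.

Lemma cmp_sum_inj i : exists p : cmpHom (X i) cmp_sum, forall x, p x = inS i x.
Proof.
apply: (@cmpHom_ex (X i) cmp_sum) => [K CK|K L CK CL]; last first.
  exact: famI (compactologyP (X i)) _ _ CK (CL i).
by apply: sum_part.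
Qed.

Lemma sum_fiberE (K : set {i & X i}) :
  K = \bigcup_i [set inS i x | x in fiber K i].
Proof.
apply/seteqP; split=> [[i x] Kx|_ [i _ [x Kx <-]]//].
by exists i => //; exists x.
Qed.

Lemma cmp_sum_desc (Z : cmpSet) (h : forall i, cmpHom (X i) Z) :
  exists u : cmpHom cmp_sum Z, forall i x, u (inS i x) = h i x.
Proof.
have [||u uE] := @cmpHom_ex cmp_sum Z (fun t => h (tag t) (tagged t)).
- move=> K CK; rewrite (sum_fiberE K) image_bigcup.
  apply: finite_bigcup_ind => [||i]; first exact: fam0 (compactologyP Z).
    exact: famU (compactologyP Z).
  by rewrite image_comp; exact: (hom_image (h i) (CK i)).
- by move=> K L CK CL i; exact: (hom_preimage (h i) (CK i) CL).
by exists u => i x; rewrite uE.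
Qed.

End Sum.

(** Quotient projections have this property; it gives surjectivity and carries size bounds on
    compact sets from [X] to [Q]. *)
Definition image_covering (X Q : cmpSet) (q : cmpHom X Q) :=
  forall K, compactology K -> exists2 L, compactology L & K = q @` L.

Lemma image_covering_surj (X Q : cmpSet) (q : cmpHom X Q) :
  image_covering q -> forall t, exists x, q x = t.
Proof.
move=> qC t; have [L _ tL] := qC _ (fam1 (compactologyP Q) t).
have : [set t] t by [].
by rewrite tL => -[x _ xt]; exists x.
Qed.

Lemma kernel_quotient (X : cmpSet) (T : Type) (r : X -> T) :
  (forall K L, compactology K -> compactology L ->
    compactology (K `&` r @^-1` (r @` L))) ->
  exists (Q : cmpSet) (q : cmpHom X Q),
    [/\ image_covering q, forall x y, q x = q y <-> r x = r y &
        forall (Z : cmpSet) (h : cmpHom X Z),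
          (forall x y, r x = r y -> h x = h y) ->
          exists u : cmpHom Q Z, forall x, u (q x) = h x].
Proof.
move=> r_sat.
pose r' x : range r := SigSub (mem_set (imageT r x)).
have r'E x y : r' x = r' y <-> r x = r y.
  by split=> [/(congr1 val)//|rxy]; exact/val_inj.
have r'_surj t : exists x, r' x = t.
  by have [x _ xt] := set_mem (valP t); exists x; exact/val_inj.
have r'_sat K L : compactology K -> compactology L ->
    compactology (K `&` r' @^-1` (r' @` L)).
  move=> CK CL; suff -> : K `&` r' @^-1` (r' @` L) = K `&` r @^-1` (r @` L).
    exact: r_sat.
  apply/seteqP; split=> x [Kx [y Ly yx]]; split=> //; exists y => //.
    exact/r'E.
  exact/r'E.
have [q qE] := quotient_proj r'_surj r'_sat.
exists (quotient r'_surj r'_sat), q; split.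
- move=> _ [L CL <-]; exists L => //.
  by congr (_ @` _); apply/funext => x; rewrite qE.
- by move=> x y; rewrite !qE; exact: r'E.
- move=> Z h hr; have [|u uE] := quotient_desc r'_surj r'_sat (h := h).
    by move=> x y /r'E; exact: hr.
  by exists u => x; rewrite qE.
Qed.

(** * Closed relations and colimits *)

(* The complement of [R] in [K * K] is open: around a pair outside [R] there is
   a rectangle, here given by its complementary compact sets, disjoint from [R]. *)
Definition closed_relation (X : cmpSet) (R : X -> X -> Prop) :=
  forall K x y, compactology K -> K x -> K y -> ~ R x y ->
    exists A B, [/\ compactology A, compactology B, ~ A x, ~ B y &
      forall x' y', K x' -> K y' -> R x' y' -> A x' \/ B y'].

(** For [x] related to no point of [L], [compact_avoid] combines the rectangles around the pairs
    [(x, y)] into one [A] that misses [x] and contains every point of [K] related to a point of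
    [L]. *)
Lemma closed_relation_saturation (X : cmpSet) (R : X -> X -> Prop) K L :
  closed_relation R -> compactology K -> compactology L ->
  compactology (K `&` [set x | exists2 y, L y & R x y]).
Proof.
move=> Rcl CK CL; have CX := compactologyP X.
have CM : compactology (K `|` L) by exact: famU.
apply: (compact_of_points CX CK) => [x []//|x Kx xR].
have [||||y Ly|B [CB [A [CA Ax AB]]] BL] := @compact_avoid _ _ CX
    [set B | compactology B /\ exists A, [/\ compactology A, ~ A x &
      forall x' y', K x' -> L y' -> R x' y' -> A x' \/ B y']] L.
- by move=> B [].
- by exists L; split=> //; exists set0; split=> //; [exact: fam0|right].
- move=> B B' [CB [A [CA Ax AB]]] [CB' [A' [CA' Ax' AB']]].
  split; first exact: famI.
  exists (A `|` A'); split; [exact: famU|by case|move=> x' y' Kx' Ly' xy].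
  have [Ax'1|By] := AB _ _ Kx' Ly' xy; first by left; left.
  by have [Ax'1|By'] := AB' _ _ Kx' Ly' xy; [left; right|right].
- exact: CL.
- have [|||A [B [CA CB Ax By AB]]] := Rcl (K `|` L) x y CM.
  + by left.
  + by right.
  + by move=> xy; apply: xR; split=> //; exists y.
  exists B => //; split=> //; exists A; split=> // x' y' Kx' Ly'.
  by apply: AB; [left|right].
exists A; split=> // x' [Kx' [y' Ly' xy']].
have [//|By'] := AB _ _ Kx' Ly' xy'.
suff : (set0 : set X) y' by [].
by rewrite -BL.
Qed.

Definition constant_on (X : cmpSet) (D : X -> X -> Prop) (T : Type) (h : X -> T) :=
  forall x y, D x y -> h x = h y.

Lemma quotient_by_relation (X : cmpSet) (D : X -> X -> Prop) :
  exists (Q : cmpSet) (q : cmpHom X Q),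
    [/\ image_covering q, constant_on D q &
        forall (Z : cmpSet) (h : cmpHom X Z), constant_on D h ->
          exists u : cmpHom Q Z, forall x, u (q x) = h x].
Proof.
(* [R] is the intersection of the kernels of all morphisms constant on [D], so such morphisms factor
   once the quotient by [R] exists; a morphism distinguishing [x] and [y] pulls back a separation of
   their images, which makes [R] closed. *)
pose R (x y : X) : Prop :=
  forall (Z : cmpSet) (h : cmpHom X Z), constant_on D h -> h x = h y.
have Rcl : closed_relation R.
  move=> K x y CK Kx Ky nR; apply: contrapT => nAB; apply: nR => Z h hD.
  apply: contrapT => hxy; apply: nAB.
  have [||//|A [B [CA CB KAB Ax By]]] := fam_sep (compactologyP Z)
    (x := h x) (y := h y) (hom_image h CK).
  - by exists x.
  - by exists y.
  exists (K `&` h @^-1` A), (K `&` h @^-1` B).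
  split; [exact: hom_preimage|exact: hom_preimage|by case|by case|].
  move=> x' y' Kx' Ky' /(_ _ _ hD) hxy'.
  have [|Ax'|Bx'] := KAB (h x'); [by exists x'|by left|right].
  by split=> //=; rewrite -hxy'.
(* [R x] is the equivalence class of [x], so [R] itself serves as the map to the set of classes. *)
have RE x y : R x = R y <-> R x y.
  split=> [->//|xy].
  apply/funext => z; apply/propext.
  by split=> xz Z h hD; [rewrite -(xy _ _ hD)|rewrite (xy _ _ hD)]; exact: xz.
have [|Q [q [qC qE qU]]] := @kernel_quotient X (X -> Prop) R.
  move=> K L CK CL; have := closed_relation_saturation Rcl CK CL.
  congr compactology; apply/seteqP; split=> x [Kx [y Ly xy]];
    split=> //; exists y => //.
    exact/esym/RE.
  exact/RE/esym.
exists Q, q; split=> //.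
- by move=> x y Dxy; apply/qE/RE => Z h hD; exact: hD.
- by move=> Z h hD; apply: qU => x y /RE xy; exact: xy.
Qed.

Lemma finite_coproduct (J : Type) (X : J -> cmpSet) n (e : 'I_n -> J) :
  bijective e ->
  let S := cmp_sum (fun i => X (e i)) in
  exists p : forall j, cmpHom (X j) S,
    (forall s : S, exists j x, p j x = s) /\
    forall (Z : cmpSet) (h : forall j, cmpHom (X j) Z),
      exists u : cmpHom S Z, forall j x, u (p j x) = h j x.
Proof.
move=> [e' eK e'K] S.
have [inj injE] : exists inj : forall i, cmpHom (X (e i)) S,
    forall i x, inj i x = existT _ i x.
  have /all_sig[inj injE] i := cid (cmp_sum_inj (fun i => X (e i)) i).
  by exists inj.
(* An equation between dependent pairs carries the index along and avoids transport between [X j]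
   and [X (e i)]. *)
have pE j : exists (p : cmpHom (X j) S) i,
    existT (fun j => cmpHom (X j) S) j p = existT _ (e i) (inj i).
  by rewrite -(e'K j); exists (inj (e' j)), (e' j).
have [p /= {}pE] := all_sig (fun j => cid (pE j)).
exists p; split.
  move=> [i x]; have [k pk] := pE (e i).
  have ik : i = k by apply: (can_inj eK); exact: (congr1 (@projT1 _ _) pk).
  subst k; have pe := Eqdep.EqdepTheory.inj_pair2 _ _ _ _ _ pk.
  by exists (e i), x; rewrite pe injE.
move=> Z h; have [u uE] := cmp_sum_desc (fun i => h (e i)).
exists u => j; have [i pi] := pE j.
have : forall t : {j & cmpHom (X j) S}, t = existT _ (e i) (inj i) ->
    forall x, u (projT2 t x) = h (projT1 t) x.
  by move=> _ -> x /=; rewrite injE uE.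
by move=> /(_ _ pi).
Qed.

(** * Closed embeddings and their pushouts *)

Definition closed_embedding (A X : cmpSet) (i : cmpHom A X) :=
  injective i /\ forall K, compactology K -> compactology (i @^-1` K).

Lemma equalizer_exists (X Y : cmpSet) (f g : cmpHom X Y) :
  exists (E : cmpSet) (e : cmpHom E X),
    [/\ closed_embedding e, forall t, f (e t) = g (e t) &
        forall (Z : cmpSet) (h : cmpHom Z X), (forall z, f (h z) = g (h z)) ->
          exists u : cmpHom Z E, forall z, e (u z) = h z].
Proof.
pose E := [set x | f x = g x]; pose i (t : E) : X := val t.
have inj_i : injective i by exact: val_inj.
have [e eE] := induced_incl inj_i.
exists (induced inj_i), e; split.
- split=> [s t|K CK]; first by rewrite !eE => /inj_i.
  change (compactology (i @` (e @^-1` K))).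
  rewrite (_ : _ @` _ = K `&` E); last first.
    apply/seteqP; split=> [_ [t Kt <-]|x [Kx Ex]].
      by split; [move: Kt; rewrite /= eE|exact: set_mem (valP t)].
    by exists (SigSub (mem_set Ex)) => //=; rewrite eE.
  have CX := compactologyP X; have CY := compactologyP Y.
  apply: (compact_of_points CX CK) => [x []//|x Kx nE].
  have CM : compactology (f @` K `|` g @` K).
    by apply: (famU CY); exact: hom_image.
  have [|||A [B [CA CB KAB Ax By]]] := fam_sep CY (x := f x) (y := g x) CM.
  + by left; exists x.
  + by right; exists x.
  + by move=> fg; apply: nE.
  (* Where [f] and [g] agree, the common value lies in [A] or in [B]; but [A] misses [f x] and [B]
     misses [g x]. *)
  exists (K `&` f @^-1` A `|` K `&` g @^-1` B); split.
  + by apply: (famU CX); exact: hom_preimage.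
  + move=> z [Kz Ez]; have [|Az|Bz] := KAB (f z); [by left; exists z|by left|right].
    by split=> //=; rewrite -[g z]Ez.
  + by move=> [[_ /Ax]|[_ /By]].
- by move=> t; rewrite eE; exact: set_mem (valP t).
- move=> Z h hE; pose u z : E := SigSub (mem_set (hE z : E (h z))).
  have [|v vE] := induced_lift inj_i (f := h) (u := u); first by [].
  by exists v => z; rewrite eE vE.
Qed.

(** This serves to compare a regular monomorphism [i] with an explicit equalizer [e]: preimages
    along [i] are images under [u] of preimages along [e]. *)
Lemma closed_embedding_retract (A E X : cmpSet) (i : cmpHom A X) (e : cmpHom E X)
    (u : cmpHom E A) (v : cmpHom A E) :
  closed_embedding e -> (forall t, i (u t) = e t) -> (forall a, e (v a) = i a) ->
  (forall a, u (v a) = a) -> closed_embedding i.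
Proof.
move=> [inj_e eK] iu ev uv; split=> [a b ab|K CK].
  by rewrite -(uv a) -(uv b); congr (u _); apply: inj_e; rewrite !ev.
suff -> : i @^-1` K = u @` (e @^-1` K) by apply: hom_image; exact: eK.
apply/seteqP; split=> [a Ka|_ [t Kt <-]]; last by rewrite /= iu.
by exists (v a) => //=; rewrite ev.
Qed.

(** This serves to compare an arbitrary pushout [X] with the explicit one [Y]: preimages along [j]
    are preimages along [j'] of images under [u]. *)
Lemma closed_embedding_section (A X Y : cmpSet) (j : cmpHom A X)
    (j' : cmpHom A Y) (u : cmpHom X Y) (w : cmpHom Y X) :
  closed_embedding j' -> (forall a, u (j a) = j' a) -> (forall a, w (j' a) = j a) ->
  (forall x, w (u x) = x) -> closed_embedding j.
Proof.
move=> [inj_j' j'K] uj wj wu; split=> [a b ab|K CK].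
  by apply: inj_j'; rewrite -!uj ab.
suff -> : j @^-1` K = j' @^-1` (u @` K) by apply: j'K; exact: hom_image.
apply/seteqP; split=> [a Ka|a [x Kx xa]]; first by exists (j a).
by rewrite /= -wj -xa wu.
Qed.

(** The factorization is a morphism since [u(K) = i^-1(h(K))] and [u^-1(L) = h^-1(i(L))]. *)
Lemma closed_embedding_lift (A X Z : cmpSet) (i : cmpHom A X) (h : cmpHom Z X) :
  closed_embedding i -> (forall z, exists a, i a = h z) ->
  exists u : cmpHom Z A, forall z, i (u z) = h z.
Proof.
move=> [inj_i iK] /choice[u iu].
have [||v vE] := @cmpHom_ex Z A u; last by exists v => z; rewrite vE.
- move=> K CK; suff -> : u @` K = i @^-1` (h @` K) by apply: iK; exact: hom_image.
  apply/seteqP; split=> [_ [z Kz <-]|a [z Kz za]]; first by exists z.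
  by exists z => //; apply: inj_i; rewrite iu.
- move=> K L CK CL; suff -> : K `&` u @^-1` L = K `&` h @^-1` (i @` L).
    by apply: hom_preimage => //; exact: hom_image.
  apply/seteqP; split=> [z [Kz Lz]|z [Kz [a La az]]]; split=> //.
    by exists (u z).
  by rewrite /= (_ : u z = a)//; apply: inj_i; rewrite iu.
Qed.

(* As a set, the pushout of a closed embedding [i] along [h] is
   [B + (X \ i A)]. *)
Lemma closed_embedding_pushout (A X B : cmpSet) (i : cmpHom A X) (h : cmpHom A B) :
  closed_embedding i ->
  let S := cmp_sum (fun b : bool => if b then X else B) in
  exists (P : cmpSet) (q : cmpHom S P) (k : cmpHom X P) (j : cmpHom B P),
    [/\ image_covering q, closed_embedding j,
      forall a, k (i a) = j (h a),
      forall x b, k x = j b -> exists a, i a = x &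
      forall (Z : cmpSet) (f : cmpHom X Z) (g : cmpHom B Z),
        (forall a, f (i a) = g (h a)) ->
        exists u : cmpHom P Z, (forall x, u (k x) = f x) /\ forall b, u (j b) = g b].
Proof.
move=> [inj_i iK]; set XB := fun b : bool => _; move=> S.
have CX := compactologyP X; have CB := compactologyP B.
(* [rX] computes normal forms: [i a] becomes [h a] in [B], and any other point of [X] stays
   itself. *)
have /choice[rX rXP] : forall x, exists y : B + X,
    (exists2 a, i a = x & y = inl (h a)) \/ ((forall a, i a <> x) /\ y = inr x).
  move=> x; have [[a ax]|nx] := pselect (exists a, i a = x).
    by exists (inl (h a)); left; exists a.
  by exists (inr x); right; split=> // a ax; apply: nx; exists a.
have rXi a : rX (i a) = inl (h a).
  by case: (rXP (i a)) => [[a' /inj_i -> ->]//|[/(_ a)]].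
pose inX x : S := existT (fun b => XB b) true x.
pose inB b : S := existT (fun b => XB b) false b.
pose r (t : S) : B + X :=
  match t with existT b z =>
    (if b return XB b -> B + X then rX else inl) z end.
have rX_inl x b : rX x = inl b -> exists2 a, i a = x & h a = b.
  by case: (rXP x) => [[a ax ->] [hb]|[_ ->]//]; exists a.
have r_sat K L : compactology K -> compactology L ->
    compactology (K `&` r @^-1` (r @` L)).
  move=> CK CL.
  (* [M] is the part in [B] of the saturation of [L]. *)
  pose M := inB @^-1` L `|` h @` (i @^-1` (inX @^-1` L)).
  have CM : compactology M.
    apply: (famU CB); first exact: (CL false).
    by apply: hom_image; apply: iK; exact: (CL true).
  have ME b : (r @` L) (inl b) <-> M b.
    split=> [[[[|] z] Lz /= rz]|[Lb|[a La <-]]].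
    - by have [a az ab] := rX_inl _ _ rz; right; exists a; rewrite //= az.
    - by case: rz => <-; left.
    - by exists (inB b).
    - by exists (inX (i a)) => //=; rewrite rXi.
  have CT : compactology (inX @^-1` K) by exact: (CK true).
  have CF : compactology (inB @^-1` K) by exact: (CK false).
  suff : forall b, compactology (@fiber _ XB (K `&` r @^-1` (r @` L)) b) by [].
  case.
    change (compactology (inX @^-1` (K `&` r @^-1` (r @` L)))).
    (* A point of [X] is in the saturation of [L] iff it lies in [L] already or is some [i a] with
       [h a] in [M]. *)
    rewrite (_ : _ @^-1` _ = inX @^-1` K `&` (inX @^-1` L `|`
        i @` (i @^-1` (inX @^-1` K) `&` h @^-1` M))).
      apply: (famI CX) => //; apply: (famU CX); first exact: (CL true).
      by apply: hom_image; apply: hom_preimage => //; exact: iK.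
    apply/seteqP; split=> x [Kx].
      move=> xL; split=> //.
      case: (rXP x) => [[a ax xa]|[nx xx]].
        right; exists a => //; split; first by rewrite /= ax.
        by apply/ME; rewrite -xa.
      left; move: xL; rewrite /= xx => -[[[|] z] Lz /= rz] //.
      case: (rXP z) => [[a _ za]|[_ zz]]; first by rewrite za in rz.
      by move: rz; rewrite zz => -[<-].
    move=> [Lx|[a [_ /ME Ma] ax]]; split=> //; first by exists (inX x).
    by rewrite /= -ax rXi.
  change (compactology (inB @^-1` (K `&` r @^-1` (r @` L)))).
  rewrite (_ : _ @^-1` _ = inB @^-1` K `&` M); first exact: famI.
  by apply/seteqP; split=> b [Kb /ME Mb].
have [P [q [qC qE qU]]] := kernel_quotient r_sat.
have [inX' inX'E] := cmp_sum_inj XB true.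
have [inB' inB'E] := cmp_sum_inj XB false.
pose k := cmpHom_comp q inX'; pose j := cmpHom_comp q inB'.
have kE x : k x = q (inX x) by rewrite /= inX'E.
have jE b : j b = q (inB b) by rewrite /= inB'E.
exists P, q, k, j; split=> //.
- split=> [b b'|K]; first by rewrite !jE => /qE [].
  move=> /qC [L CL ->].
  rewrite (_ : _ @^-1` _ = inB @^-1` L `|` h @` (i @^-1` (inX @^-1` L))).
    apply: (famU CB); first exact: (CL false).
    by apply: hom_image; apply: iK; exact: (CL true).
  apply/seteqP; split=> b.
    move=> Lb; have : (q @` L) (q (inB b)) by rewrite -jE.
    move=> [[[|] z] Lz /qE /= rz].
      by have [a az ab] := rX_inl _ _ rz; right; exists a; rewrite //= az.
    by case: rz => <-; left.
  move=> Lb; change ((q @` L) (j b)); rewrite jE.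
  move: Lb => [Lb|[a La ab]]; first by exists (inB b).
  by exists (inX (i a)) => //; apply/qE; rewrite /= rXi ab.
- by move=> a; rewrite kE jE; apply/qE; rewrite /= rXi.
- by move=> x b; rewrite kE jE => /qE /= /rX_inl [a]; exists a.
- move=> Z f g fg.
  have [v vE] := @cmp_sum_desc _ XB Z
    (fun b => if b return cmpHom (XB b) Z then f else g).
  have vX x : v (inX x) = f x by exact: (vE true).
  have vB b : v (inB b) = g b by exact: (vE false).
  (* The map [v] on the sum depends only on normal forms, because [f] and [g] agree along [A]. *)
  pose w (y : B + X) := match y with inl b => g b | inr x => f x end.
  have vw t : v t = w (r t).
    case: t => [[|] z] /=; last exact: vB.
    rewrite [LHS]vX; case: (rXP z) => [[a <- ->]|[_ ->]//]; exact: fg.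
  have [|u uE] := qU Z v; first by move=> s t st; rewrite !vw st.
  by exists u; split=> [x|b]; rewrite ?kE ?jE uE.
Qed.

(** * Coregularity of full subcategories *)

(** Indexing the objects covers both categories at once: [Cmp] is the case of the identity,
    [Cmp_kappa] that of [proj1_sig]. *)
Definition category_over (I : Type) (o : I -> Cmp) : category :=
  {| ob := I;
     hom := fun x y => @hom Cmp (o x) (o y);
     idm := fun x => @idm Cmp (o x);
     comp := fun x y z g f => @comp Cmp _ _ _ g f;
     comp1m := fun x y f => @comp1m Cmp _ _ f;
     compm1 := fun x y f => @compm1 Cmp _ _ f;
     compA := fun x y z w h g f => @compA Cmp _ _ _ _ h g f |}.

Section Coregular.
Variables (I : Type) (o : I -> cmpSet) (P : cmpSet -> Prop).
Hypothesis Po : forall i, P (o i).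
Hypothesis oP : forall X, P X -> exists i, o i = X.
Hypothesis P_inj : forall (X Y : cmpSet) (e : cmpHom Y X), injective e -> P X -> P Y.
Hypothesis P_quot : forall (X Q : cmpSet) (q : cmpHom X Q),
  image_covering q -> P X -> P Q.
Hypothesis P_sum : forall (J : finType) (X : J -> cmpSet),
  (forall j, P (X j)) -> P (cmp_sum X).

Let C := @category_over I o.

Let homE (x y : I) (f g : cmpHom (o x) (o y)) :
  (f = g :> @hom C x y) <-> forall t, f t = g t.
Proof. by split=> [->//|fg]; exact: cmpHom_eq. Qed.

Lemma category_over_finite_colimits : has_finite_limits (opposite C).
Proof.
move=> J F [[n [e e_bij]] _].
pose Y j := o (F j).
have [p [p_surj p_desc]] := finite_coproduct Y e_bij.
set S := cmp_sum _ in p p_surj p_desc *.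
have PS : P S by apply: P_sum => i; exact: Po.
(* [F] takes values in the opposite category, so [fmor F a] maps [Y j] to [Y i]; the colimit is the
   sum with each point identified with its images. *)
pose D (s t : S) : Prop := exists (i j : J) (a : hom i j) (x : Y j),
  s = p i ((fmor F a : cmpHom (Y j) (Y i)) x) /\ t = p j x.
have [Q [q [qC qD q_desc]]] := quotient_by_relation D.
have [L oL] := oP (P_quot qC PS); subst Q.
exists L, (fun j => cmpHom_comp q (p j) : @hom (opposite C) L (F j)); split.
  move=> i j a; apply/homE => x /=; apply: qD.
  by exists i, j, a, x.
move=> Z z zP.
have [u uE] := p_desc (o Z) z.
have [|v vE] := q_desc (o Z) u.
  move=> _ _ [i [j [a [x [-> ->]]]]]; rewrite !uE.
  by have /homE /(_ x) := zP i j a.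
exists v; split=> [j|w wE].
  by apply/homE => x /=; rewrite vE uE.
apply/homE => t; have [s <-] := image_covering_surj qC t.
have [j [x <-]] := p_surj s.
rewrite vE uE; have /homE /(_ x) /= := wE j.
by move=> ->.
Qed.

Lemma category_over_equalizers : kernel_pairs_have_coequalizers (opposite C).
Proof.
move=> X Y K f p1 p2 _.
have [E [e [[inj_e _] eE e_lift]]] :=
  equalizer_exists (p1 : cmpHom (o X) (o K)) (p2 : cmpHom (o X) (o K)).
have [L oL] := oP (P_inj inj_e (Po X)); subst E.
exists L, e; split; first exact/homE.
move=> Z h /homE hE; have [u uE] := e_lift (o Z) h hE.
exists u; split=> [|v /homE vE]; first exact/homE.
by apply/homE => z; apply: inj_e; rewrite uE; apply/esym/vE.
Qed.

Lemma regular_mono_closed_embedding (A X : I) (i : @hom C A X) :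
  @regular_epi (opposite C) X A i -> closed_embedding (i : cmpHom (o A) (o X)).
Proof.
move=> [Y [f [g [/homE fg i_lift]]]].
have [E [e [e_emb eE e_lift]]] :=
  equalizer_exists (f : cmpHom (o X) (o Y)) (g : cmpHom (o X) (o Y)).
have [L oL] := oP (P_inj e_emb.1 (Po X)); subst E.
have fe : @comp C L X Y f e = @comp C L X Y g e by exact/homE.
have [u [/homE iu _]] := i_lift L e fe.
have [v ev] := e_lift (o A) i fg.
apply: (closed_embedding_retract (u := u) (v := v) e_emb iu ev).
have fi : @comp C A X Y f i = @comp C A X Y g i by exact/homE.
(* Both the identity and [u] followed after [v] factor [i] through itself, hence coincide. *)
have [w [_ w_uniq]] := i_lift A i fi.
have w1 : w = @idm C A by apply: w_uniq; exact/homE.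
have wuv : w = @comp C _ _ _ u v.
  by apply: w_uniq; apply/homE => a; rewrite -ev; exact: iu.
move=> a; have := w1; rewrite wuv => /homE /(_ a); exact.
Qed.

Lemma sum_bool (X B : cmpSet) : P X -> P B ->
  P (cmp_sum (fun b : bool => if b then X else B)).
Proof. by move=> PX PB; apply: P_sum; case. Qed.

Lemma closed_embedding_regular_mono (A X : I) (i : @hom C A X) :
  closed_embedding (i : cmpHom (o A) (o X)) -> @regular_epi (opposite C) X A i.
Proof.
move=> i_emb.
have [Q [q [k [j [qC [inj_j _] kj kjE _]]]]] :=
  closed_embedding_pushout (i : cmpHom (o A) (o X)) i_emb.
have [L oL] := oP (P_quot qC (sum_bool (Po X) (Po X))); subst Q.
exists L, k, j; split; first exact/homE.
move=> Z h /homE hE.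
have [z|u uE] := closed_embedding_lift (h := h) i_emb; first exact: kjE (hE z).
exists u; split=> [|v /homE vE]; first exact/homE.
by apply/homE => z; apply: i_emb.1; rewrite uE; apply/esym/vE.
Qed.

(** [Q] is known only by its universal property, so [j] is compared with the embedding [j'] into the
    explicit pushout; uniqueness makes [w] after [u] the identity of [Q]. *)
Lemma category_over_regular_mono_pushout :
  regular_epis_stable_under_pullback (opposite C).
Proof.
move=> X B A Q h i j k [/homE hi Q_desc] /regular_mono_closed_embedding i_emb.
apply: closed_embedding_regular_mono.
have [Q' [q [k' [j' [qC j'_emb k'j' _ q_desc]]]]] :=
  closed_embedding_pushout (h : cmpHom (o A) (o X)) i_emb.
have [L oL] := oP (P_quot qC (sum_bool (Po B) (Po X))); subst Q'.
have jk' : @comp C A X L j' h = @comp C A B L k' i.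
  by apply/homE => a; rewrite /= k'j'.
have [u [[/homE uj /homE uk] _]] := Q_desc L j' k' jk'.
have [w [wk wj]] := q_desc (o Q) k j (fun a => esym (hi a)).
apply: (closed_embedding_section (u := u) (w := w) j'_emb uj wj).
have jk : @comp C A X Q j h = @comp C A B Q k i by exact/homE.
have [v [_ v_uniq]] := Q_desc Q j k jk.
have v1 : v = @idm C Q by apply: v_uniq; split; exact/homE.
have vwu : v = @comp C Q L Q w u.
  apply: v_uniq; split; apply/homE => x.
    by rewrite -wj; congr (w _); exact: uj.
  by rewrite -wk; congr (w _); exact: uk.
by move=> x; have := v1; rewrite vwu => /homE /(_ x).
Qed.

Lemma category_over_coregular : coregular C.
Proof.
split; [exact: category_over_finite_colimits|exact: category_over_equalizers|].
exact: category_over_regular_mono_pushout.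
Qed.

End Coregular.

(** * Cardinals below a strong limit *)

(** Relations in place of functions spare subtypes and default values outside [A]. *)
Lemma card_le_relP (T U : Type) (A : set T) (B : set U) :
  A #<= B <-> exists R : T -> U -> Prop,
    (forall a, A a -> exists2 b, B b & R a b) /\
    (forall a a' b, A a -> A a' -> R a b -> R a' b -> a = a').
Proof.
split=> [/card_leP[f]|[R [AB R_inj]]].
  exists (fun a b => exists2 z : A, val z = a & val (f z) = b); split.
    move=> a Aa; pose z : A := SigSub (mem_set Aa).
    by exists (val (f z)); [exact: set_mem (valP (f z))|exists z].
  move=> _ _ _ _ _ [z <- <-] [w <- /val_inj fwz]; congr val.
  by apply: (@inj _ _ _ f) => //; apply/mem_set.
have /choice[f fP] : forall z : A, exists b, B b /\ R (val z) b.
  move=> z; have [b Bb Rb] := AB _ (set_mem (valP z)).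
  by exists b.
have <- : val @` [set: A] = A.
  apply/seteqP; split=> [_ [z _ <-]|a Aa]; first exact: set_mem (valP z).
  by exists (SigSub (mem_set Aa)).
apply: (card_le_trans (card_image_le _ _)).
have f_inj : {in [set: A] &, injective f}.
  move=> z w _ _ fzw; apply: val_inj.
  have [_ Rz] := fP z; have [_ Rw] := fP w; rewrite -fzw in Rw.
  by apply: R_inj Rz Rw; exact: set_mem (valP _).
rewrite -(card_le_eql (inj_card_eq f_inj)); apply: subset_card_le.
by move=> _ [z _ <-]; have [] := fP z.
Qed.

(** By Zorn's lemma there is a maximal partial injection; it is defined on all of [A] or reaches all
    of [B], as otherwise a pair [(a, b)] could be added. *)
Lemma card_le_total (T U : Type) (A : set T) (B : set U) : A #<= B \/ B #<= A.
Proof.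
pose inj (R : set (T * U)) := forall p q, R p -> R q ->
  [/\ A p.1, B p.2 & (p.1 = q.1 <-> p.2 = q.2)].
have [F Finj Ftot|R [R_inj R_max]] := @Zorn_bigcup _ inj.
  move=> p q [X FX Xp] [Y FY Yq].
  by have [XY|YX] := Ftot _ _ FX FY;
    [apply: (Finj _ FY p q) => //; exact: XY|apply: (Finj _ FX p q) => //; exact: YX].
have [AR|/existsNP[a /not_implyP[Aa nRa]]] :=
    pselect (forall a, A a -> exists b, R (a, b)).
  left; apply/card_le_relP; exists (fun a b => R (a, b)); split=> [a /AR[b Rab]|].
    by exists b => //; have [] := R_inj _ _ Rab Rab.
  by move=> a a' b _ _ Rab Ra'b; have [_ _ /= [_]] := R_inj _ _ Rab Ra'b; exact.
right; apply/card_le_relP; exists (fun b a => R (a, b)); split; last first.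
  by move=> b b' c _ _ Rab Rab'; have [_ _ /= []] := R_inj _ _ Rab Rab'; auto.
move=> b Bb; apply: contrapT => nRb.
apply: (R_max (R `|` [set (a, b)])).
  split; first by left.
  by move=> /(_ (a, b)) Rab; apply: nRa; exists b; apply: Rab; right.
have nRa' c : ~ R (a, c) by move=> Rac; apply: nRa; exists c.
have nRb' c : ~ R (c, b).
  by move=> Rcb; apply: nRb; exists c => //; have [] := R_inj _ _ Rcb Rcb.
move=> [p1 p2] [q1 q2] [Rp|[-> ->]] [Rq|[-> ->]] //=.
- exact: (R_inj _ _ Rp Rq).
- have [Ap Bp _] := R_inj _ _ Rp Rp; split=> //.
  by split=> [pa|pb]; [case: (nRa' p2); rewrite -pa|case: (nRb' p1); rewrite -pb].
- split=> //.
  by split=> [qa|qb]; [case: (nRa' q2); rewrite qa|case: (nRb' q1); rewrite qb].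
Qed.

(** An injection acts injectively on subsets by direct image. *)
Lemma card_le_powerset (T U : Type) (A : set T) (B : set U) :
  A #<= B -> [set D | D `<=` A] #<= [set D | D `<=` B].
Proof.
move=> /card_le_relP[R [AB R_inj]]; apply/card_le_relP.
exists (fun D E => E = [set b | B b /\ exists2 a, D a & R a b]); split=> [D DA|].
  by exists [set b | B b /\ exists2 a, D a & R a b] => // b [].
have sub D D' : D `<=` A -> D' `<=` A ->
    [set b | B b /\ exists2 a, D a & R a b] `<=`
      [set b | B b /\ exists2 a, D' a & R a b] -> D `<=` D'.
  move=> DA D'A DD' a Da; have [b Bb Rab] := AB _ (DA _ Da).
  have [|_ [a' D'a' Ra'b]] := DD' b; first by split=> //; exists a.
  by rewrite (R_inj a a' b (DA _ Da) (D'A _ D'a') Rab Ra'b).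
move=> D D' E DA D'A -> E'; apply/seteqP.
by split; apply: sub => //; rewrite E'.
Qed.

(** * Closure properties of the sets smaller than [kappa] *)

Section Small.
Variable kappa : Type.
Hypotheses (kappa_unc : uncountable kappa) (kappa_lim : strong_limit kappa).

Lemma card_ltP (T : Type) (A : set T) :
  card_lt A [set: kappa] <-> ~ ([set: kappa] #<= A).
Proof.
split=> [/andP[_ /negP]//|nA]; apply/andP; split; last exact/negP.
by have [//|/nA] := card_le_total A [set: kappa].
Qed.

Lemma card_lt_le (T U : Type) (A : set T) (B : set U) :
  A #<= B -> card_lt B [set: kappa] -> card_lt A [set: kappa].
Proof.
by move=> AB /card_ltP nB; apply/card_ltP => kA; apply: nB; exact: card_le_trans AB.
Qed.

Lemma card_lt0 (T : Type) : card_lt (@set0 T) [set: kappa].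
Proof.
(* Uncountability excludes an empty [kappa]. *)
apply/card_ltP => k0; apply: kappa_unc.
rewrite /countable; apply: card_le_trans k0 _; exact: card_ge0.
Qed.

Lemma card_lt_powerset (T : Type) (A : set T) :
  card_lt A [set: kappa] -> card_lt [set D | D `<=` A] [set: kappa].
Proof.
move=> /[dup] Ak /andP[/card_leP[f] _].
(* [strong_limit] speaks of subsets of [kappa], so [A] is replaced by its image there. *)
pose A' := (fun a => val (f a)) @` [set: A].
have [AA' A'A] : A #<= A' /\ A' #<= A.
  split; apply/card_le_relP.
    exists (fun a b => exists2 z : A, val z = a & val (f z) = b); split.
      move=> a Aa; pose z : A := SigSub (mem_set Aa).
      by exists (val (f z)); exists z.
    move=> _ _ _ _ _ [z <- <-] [w <- /val_inj fwz]; congr val.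
    by apply: (@inj _ _ _ f) => //; apply/mem_set.
  exists (fun b a => exists2 z : A, val z = a & val (f z) = b); split.
    by move=> _ [z _ <-]; exists (val z); [exact: set_mem (valP z)|exists z].
  by move=> b b' _ _ _ [z <- <-] [w /val_inj -> <-].
apply: card_lt_le (card_le_powerset AA') _; apply: kappa_lim.
exact: card_lt_le A'A Ak.
Qed.

(* [A `|` B] embeds in the double powerset of the larger of the two sets, which
   avoids the arithmetic of infinite cardinals. *)
Lemma card_ltU (T : Type) : setU_closed [set A : set T | card_lt A [set: kappa]].
Proof.
have le_ltU (A B : set T) : A #<= B -> card_lt B [set: kappa] ->
    card_lt (A `|` B) [set: kappa].
  move=> /card_le_relP[R [AB R_inj]] Bk.
  apply: card_lt_le (card_lt_powerset (card_lt_powerset Bk)).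
  apply/card_le_relP.
  (* Points of [B] are coded by [[set [set x]]], points of [A] outside [B] through a related [b] by
     [[set [set b]; set0]]; the element [set0] tells the two kinds apart. *)
  exists (fun x y => (B x /\ y = [set [set x]]) \/
    [/\ ~ B x & exists b, [/\ B b, R x b & y = [set [set b]; set0]]]).
  split=> [x ABx|].
    have [Bx|nBx] := pselect (B x).
      exists [set [set x]]; last by left.
      by move=> _ -> _ ->.
    case: ABx => [/AB[b Bb Rxb]|//].
    exists [set [set b]; set0]; last by right; split=> //; exists b.
    by move=> _ [->|->]// _ ->.
  have s1 (x y : T) : [set x] = [set y] -> x = y.
    by move=> xy; have : [set x] x by []; rewrite xy.
  have s0 (x : T) : [set x] <> set0.
    by move=> xy; have : [set x] x by []; rewrite xy.
  have n0 (x b : T) : [set [set x]] <> [set [set b]; set0].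
    move=> xb; have : [set [set b]; set0] set0 by right.
    by rewrite -xb => /esym /s0.
  move=> x x' y ABx ABx' [[Bx ->]|[nBx [b [Bb Rb ->]]]]
    [[Bx' E]|[nBx' [b' [Bb' Rb' E]]]].
  - have : [set [set x]] [set x] by [].
    by rewrite E => /s1.
  - by case: (n0 _ _ E).
  - by case: (n0 _ _ (esym E)).
  - have : [set [set b]; set0] [set b] by left.
    rewrite E => -[/s1 bb'|/s0//]; subst b'.
    case: ABx ABx' => // Ax [] // Ax'.
    exact: (R_inj _ _ _ Ax Ax' Rb Rb').
move=> A B Ak Bk; have [AB|BA] := card_le_total A B; first exact: le_ltU.
by rewrite setUC; exact: le_ltU.
Qed.

End Small.

Theorem lemma4p9 :
  coregular Cmp /\
  forall kappa : Type, uncountable kappa -> strong_limit kappa ->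
    coregular (Cmp_kappa kappa).
Proof.
split=> [|kappa kappa_unc kappa_lim].
  apply: (@category_over_coregular cmpSet id (fun=> True)) => // X _.
  by exists X.
apply: (@category_over_coregular _ (@proj1_sig Cmp _)
    (is_kappa_compactological kappa)).
- by case.
- by move=> X kX; exists (exist _ X kX).
- move=> X Y e inj_e kX K CK.
  apply: card_lt_le (kX _ (hom_image e CK)).
  by rewrite (card_le_eqr (inj_card_eq (in2W inj_e))).
- move=> X Q q qC kX K /qC [L CL ->].
  exact: card_lt_le (card_image_le _ _) (kX _ CL).
- move=> J X kX K CK; rewrite (sum_fiberE K).
  apply: (finite_bigcup_ind (P := [set A | card_lt A [set: kappa]])).
  + exact: card_lt0.
  + exact: card_ltU.
  + move=> j; apply: card_lt_le (card_image_le _ _) _.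
    exact: kX (CK j).
Qed.
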